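(* Let $\mathscr{A}$ be a unital $C^*$-algebra, $\mathscr{E}$ a Hilbert $\mathscr{A}$-module, $\mathscr{E}_1,\mathscr{E}_2$ ternary subspaces of $\mathscr{E}$, and $\mathscr{A}_i=\langle\mathscr{E}_i,\mathscr{E}_i\rangle$ for $i=1,2$. Let $z_i\in\mathscr{E}_i$ be such that $|z_i|^2a_i=a_i$ for all $a_i\in\mathscr{A}_i$ ($i=1,2$). Then $\mathscr{E}_1$ and $\mathscr{E}_2$ are module independent if and only if there are positive constants $m'$ and $M'$ such that for all norm-one elements $x_i\in\mathscr{E}_i$ ($i=1,2$) and all states $\varphi_i\in S(\mathscr{A}_i)$ with $\varphi_i(|x_i|^2)=1$ ($i=1,2$), there are $\widetilde{\varphi}_1,\widetilde{\varphi}_2\in S(\mathscr{A})$ such that $$\widetilde{\varphi}_1(|z|)\le M'\varphi_2(|z|^2)^{1/2}\ (z\in\mathscr{E}_2)\quad\text{and}\quad m'\varphi_1(|z|)\le\widetilde{\varphi}_1(|z|)\le M'\varphi_1(|z|^2)^{1/2}\ (z\in\mathscr{E}_1),$$ and $$\widetilde{\varphi}_2(|z|)\le M'\varphi_1(|z|^2)^{1/2}\ (z\in\mathscr{E}_1)\quad\text{and}\quad m'\varphi_2(|z|)\le\widetilde{\varphi}_2(|z|)\le M'\varphi_2(|z|^2)^{1/2}\ (z\in\mathscr{E}_2).$$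
   Context: A state on a $C^*$-algebra is a positive linear functional of norm one; $S(\mathscr{B})$ is the set of states of $\mathscr{B}$. Hilbert $C^*$-modules are right modules with $\mathscr{A}$-valued inner product $\langle\cdot,\cdot\rangle$, $\mathscr{A}$-linear in the second variable, and $\|x\|=\|\langle x,x\rangle\|^{1/2}$; for $x\in\mathscr{E}$, $|x|=\langle x,x\rangle^{1/2}\in\mathscr{A}$. For a closed subspace $\mathscr{F}\subseteq\mathscr{E}$, $\langle\mathscr{F},\mathscr{F}\rangle$ is the closed linear span of $\{\langle x,y\rangle:x,y\in\mathscr{F}\}$. A closed subspace $\mathscr{F}$ of $\mathscr{E}$ is ternary if $\mathscr{F}\langle\mathscr{F},\mathscr{F}\rangle\subseteq\mathscr{F}$; then $\langle\mathscr{F},\mathscr{F}\rangle$ is a $C^*$-subalgebra of $\mathscr{A}$. Ternary subspaces $\mathscr{E}_1,\mathscr{E}_2$ of $\mathscr{E}$ are (Hilbert $C^*$-)module independent if there are constants $m,M>0$ such that for all states $\varphi_i\in S(\langle\mathscr{E}_i,\mathscr{E}_i\rangle)$, $i=1,2$, there is a state $\varphi\in S(\mathscr{A})$ with $m\,\varphi_i(|x|)\le\varphi(|x|)\le M\,\varphi_i(|x|^2)^{1/2}$ for all $x\in\mathscr{E}_i$, $i=1,2$. *)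

(* Defs.v *)
From HB Require Import structures.
From mathcomp Require Import all_boot all_order all_algebra.
From mathcomp Require Import complex.
From mathcomp Require Import all_classical all_reals all_analysis.

Set Implicit Arguments.
Unset Strict Implicit.
Unset Printing Implicit Defensive.

Import Order.TTheory GRing.Theory Num.Theory.
Import numFieldNormedType.Exports.

Local Open Scope classical_set_scope.
Local Open Scope complex_scope.
Local Open Scope ring_scope.

(* Norms and functionals take their values in R[i], where x <= y means that
   y - x is a nonnegative real number. *)

(* The product and unit are fields of the mixin because Hierarchy Builder
   rejects a join of normed modules with rings: numDomainType already inherits
   from both.  The zero algebra is not excluded. *)
HB.mixin Record isCStarAlgebra (R : realType) A
    & CompleteNormedModule R[i] A := {
  cmul : A -> A -> A;
  cone : A;
  star : A -> A;
  cmulA : associative cmul;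
  cmul1l : left_id cone cmul;
  cmul1r : right_id cone cmul;
  cmulDl : left_distributive cmul +%R;
  cmulDr : right_distributive cmul +%R;
  cmulZl : forall (k : R[i]) a b, cmul (k *: a) b = k *: cmul a b;
  cmulZr : forall (k : R[i]) a b, cmul a (k *: b) = k *: cmul a b;
  starK : involutive star;
  starD : {morph star : a b / a + b};
  starZ : forall (k : R[i]) a, star (k *: a) = k^* *: star a;
  starM : forall a b, star (cmul a b) = cmul (star b) (star a);
  cmul_norm : forall a b : A, `|cmul a b| <= `|a| * `|b|;
  cstar_norm : forall a : A, `|cmul (star a) a| = `|a| ^+ 2
}.

#[short(type="cstarAlgType")]
HB.structure Definition CStarAlgebra (R : realType) :=
  {A of CompleteNormedModule R[i] A & isCStarAlgebra R A}.

Notation "a ** b" := (cmul a b) (at level 40, left associativity) : ring_scope.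

(* The positive elements of a C*-subalgebra B of A (setT for A itself): this
   form is intrinsic to B, which need not contain the unit of A. *)
Definition positive (R : realType) (A : cstarAlgType R) (B : set A) : set A :=
  [set star b ** b | b in B].

HB.mixin Record isHilbertModule (R : realType) (A : cstarAlgType R) E
    & CompleteNormedModule R[i] E := {
  ract : E -> A -> E;
  inner : E -> E -> A;
  ractA : forall x a b, ract x (a ** b) = ract (ract x a) b;
  ract1 : forall x, ract x cone = x;
  ractDl : forall x y a, ract (x + y) a = ract x a + ract y a;
  ractDr : forall x a b, ract x (a + b) = ract x a + ract x b;
  ractZl : forall (k : R[i]) x a, ract (k *: x) a = k *: ract x a;
  ractZr : forall (k : R[i]) x a, ract x (k *: a) = k *: ract x a;
  innerDr : forall x y z, inner x (y + z) = inner x y + inner x z;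
  innerZr : forall (k : R[i]) x y, inner x (k *: y) = k *: inner x y;
  innerAr : forall x y a, inner x (ract y a) = inner x y ** a;
  inner_star : forall x y, star (inner x y) = inner y x;
  inner_ge0 : forall x, positive setT (inner x x);
  inner_eq0 : forall x, inner x x = 0 -> x = 0;
  normE : forall x : E, `|x| = sqrtC `|inner x x|
}.

#[short(type="hilbertModType")]
HB.structure Definition HilbertModule (R : realType) (A : cstarAlgType R) :=
  {E of CompleteNormedModule R[i] E & isHilbertModule R A E}.

Section Defs.
Context {R : realType}.

Definition is_subspace (V : lmodType R[i]) (F : set V) : Prop :=
  submod_closed (mem F).

Definition closed_span (V : normedModType R[i]) (S : set V) : set V :=
  closure (smallest (@is_subspace V) S).

Definition functional_norm1 (A : cstarAlgType R) (B : set A)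
    (phi : A -> R[i]) : Prop :=
  @supremums _ R[i] [set `|phi b| | b in [set b | B b /\ `|b| <= 1]] 1.

(* S(B) for a C*-subalgebra B of A.  A functional on B is represented by a
   function on A, whose values outside B are irrelevant. *)
Definition state (A : cstarAlgType R) (B : set A) : set (A -> R[i]) :=
  [set phi | [/\ forall (k : R[i]) a b, B a -> B b ->
                   phi (k *: a + b) = k * phi a + phi b,
                 forall a, positive B a -> 0 <= phi a
               & functional_norm1 B phi]].

Section HilbertModuleDefs.
Context {A : cstarAlgType R} {E : hilbertModType A}.
Implicit Types (x y : E) (F : set E).

(* |x|, the positive square root of <x, x>: it exists and is unique in every
   C*-algebra, so xget selects it and the default value 0 is never used. *)
Definition mabs x : A :=
  xget 0 [set h | positive setT h /\ h ** h = inner x x].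

Definition mabs2 x : A := mabs x ** mabs x.

Definition inner_span F : set A :=
  closed_span [set inner x y | x in F & y in F].

Definition ternary F : Prop :=
  [/\ is_subspace F, closed F &
      forall x a, F x -> inner_span F a -> F (ract x a)].

Definition module_independent (E1 E2 : set E) : Prop :=
  exists m M : R, [/\ 0 < m, 0 < M &
    forall phi1 phi2 : A -> R[i],
      state (inner_span E1) phi1 -> state (inner_span E2) phi2 ->
    exists2 phi : A -> R[i], state setT phi &
      (forall x, E1 x -> m%:C * phi1 (mabs x) <= phi (mabs x)
                           <= M%:C * sqrtC (phi1 (mabs2 x))) /\
      (forall x, E2 x -> m%:C * phi2 (mabs x) <= phi (mabs x)
                           <= M%:C * sqrtC (phi2 (mabs2 x)))].

End HilbertModuleDefs.
End Defs.

(* Main.v *)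
Require Import Defs.
From mathcomp Require Import all_boot all_order all_algebra.
From mathcomp Require Import complex ring.
From mathcomp Require Import all_classical all_reals all_analysis.

Import Order.TTheory GRing.Theory Num.Theory.
Import numFieldNormedType.Exports.

Local Open Scope classical_set_scope.
Local Open Scope complex_scope.
Local Open Scope ring_scope.

(* From a state of each <E_i, E_i>, the criterion applied at x_i = z_i gives
   states psi_1, psi_2 of A, and (psi_1 + psi_2) / 2 is a common extension up to
   constants: its lower bound on E_i comes from psi_i, the other state being
   nonnegative on |x|.  For this, |z_i|^2 must be a norm-one element of
   <E_i, E_i> at which every state is 1; this follows from the Cauchy-Schwarz
   inequality, since |z_i|^2 is a left unit, hence a projection.  Conversely, a
   common extension serves as both psi_1 and psi_2. *)

(** At [k = 1] the sum [x + y] is real, and at [k = 'i] so is ['i * (x - y)]; the two conjugation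
    identities together determine [y]. *)
Lemma conj_of_real_pairing (C : numClosedFieldType) (x y : C) :
  (forall k, k^* * y + k * x \is Num.real) -> y = x^*.
Proof.
move=> real; have := conj_Creal (real 1); have := conj_Creal (real 'i).
rewrite !rmorphD !rmorphM /= !conjCK conjCi rmorph1 !mul1r !mulNr => r2 r1.
have {}r2 : y^* - x^* = x - y.
  by apply: (mulfI (neq0Ci C)); rewrite !mulrBr r2 addrC.
have : y *+ 2 = x^* *+ 2.
  rewrite !mulr2n; apply/eqP; rewrite -subr_eq0.
  have -> : y + y - (x^* + x^*) = (x + y) - (x - y) - (x^* + x^*) by ring.
  by rewrite -r2 [x + y]addrC -r1; apply/eqP; ring.
by move=> /(pmulrnI (isT : (0 < 2)%N)).
Qed.

(** * Closed linear spans in normed modules *)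

Section Subspaces.
Context {R : realType}.

Lemma lipschitz_cts (V W : normedModType R[i]) (f : V -> W) (C : R[i]) :
  (forall x y, `|f x - f y| <= C * `|x - y|) -> continuous f.
Proof.
move=> fC x; apply/cvgrPdist_lt => e e0.
(* [C] may be zero, so [|C| + 1] is the constant divided by. *)
have D0 : 0 < `|C| + 1 by rewrite ltr_wpDl.
near=> y; apply: le_lt_trans (fC x y) _.
have Cpos : 0 <= C * `|x - y| by apply: le_trans (fC x y).
rewrite -(ger0_norm Cpos) normrM normr_id.
apply: le_lt_trans (_ : (`|C| + 1) * `|x - y| < e).
  by rewrite ler_wpM2r// lerDl.
rewrite mulrC -ltr_pdivlMr//.
near: y; apply: cvgr_dist_lt; first exact: cvg_id.
by rewrite divr_gt0.
Unshelve. all: by end_near. Qed.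

Lemma continuous_closure (T U : topologicalType) (f : T -> U) (B : set T)
    (D : set U) :
  continuous f -> (forall x, B x -> D (f x)) ->
  forall x, closure B x -> closure D (f x).
Proof.
move=> fc BD; have clD : closed (f @^-1` closure D).
  by apply: preimage_closed => [x _|]; [exact: fc | exact: closed_closure].
move: clD => /closure_id clD x Bx.
suff : closure (f @^-1` closure D) x by rewrite -clD.
by move: x Bx; apply: closure_subset => x /BD; exact: subset_closure.
Qed.

Lemma is_subspaceP (V : lmodType R[i]) (F : set V) :
  is_subspace F <-> F 0 /\ forall (k : R[i]) x y, F x -> F y -> F (k *: x + y).
Proof.
rewrite /is_subspace; split=> [[F0 Fl]|[F0 Fl]].
  split=> [|k x y Fx Fy]; first by move/set_mem: F0.
  by apply/set_mem/Fl; exact/mem_set.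
split=> [|k x y /set_mem Fx /set_mem Fy]; first exact/mem_set.
exact/mem_set/Fl.
Qed.

Lemma is_subspaceZ {V : lmodType R[i]} {F : set V} (k : R[i]) x :
  is_subspace F -> F x -> F (k *: x).
Proof. by move=> /is_subspaceP[F0 Fl] Fx; rewrite -[_ *: _]addr0; exact: Fl. Qed.

Lemma is_subspaceD {V : lmodType R[i]} {F : set V} x y :
  is_subspace F -> F x -> F y -> F (x + y).
Proof. by move=> /is_subspaceP[F0 Fl] Fx Fy; rewrite -[x]scale1r; exact: Fl. Qed.

(** The algebraic span is a subspace, and [k *: x + y] is continuous in each variable separately:
    first [y], then [x], is moved from the span to its closure. *)
Lemma closed_span_subspace (V : normedModType R[i]) (S : set V) :
  is_subspace (closed_span S).
Proof.
have /is_subspaceP[sp0 spl] : is_subspace (smallest (@is_subspace R V) S).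
  apply/is_subspaceP; split=> [F [/is_subspaceP[F0 Fl] SF]//|k x y Sx Sy F [FP SF]].
  by have /is_subspaceP[F0 Fl] := FP; apply: Fl; [exact: Sx | exact: Sy].
apply/is_subspaceP; split=> [|k x y Sx Sy]; first exact: subset_closure.
apply: (@closed_closure V); move: y Sy.
apply: (@continuous_closure _ _ (fun y => k *: x + y)) => [|y Sy].
  by apply: (@lipschitz_cts V V _ 1) => u v; rewrite mul1r opprD addrACA subrr add0r.
move: x Sx; apply: (@continuous_closure _ _ (fun x => k *: x + y)) => [|x Sx].
  apply: (@lipschitz_cts V V _ `|k|) => u v.
  by rewrite opprD addrACA subrr addr0 -scalerBr normrZ.
exact: spl.
Qed.

(** An induction principle: with [F] the preimage of a closed span under a continuous map, it
    reduces a claim on the span to the generators. *)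
Lemma closed_span_min (V : normedModType R[i]) (S F : set V) :
  is_subspace F -> closed F -> S `<=` F -> closed_span S `<=` F.
Proof.
move=> Fs Fc SF; rewrite [F](closure_id _).1//; apply: closure_subset.
exact: smallest_sub.
Qed.

Lemma closed_span_gen (V : normedModType R[i]) (S : set V) : S `<=` closed_span S.
Proof. by move=> x Sx; apply: subset_closure => F [_]; exact. Qed.

End Subspaces.

(** * Norms, left units and states in C*-algebras *)

Section CStar.
Context {R : realType} {A : cstarAlgType R}.
Implicit Types (a b e : A) (B : set A) (phi : A -> R[i]).

(** The C*-identity and submultiplicativity bound the square of [|b|] by [|star b| * |b|]; cancel
    [|b|], then take [b = a] and [b = star a]. *)
Lemma star_norm a : `|star a| = `|a|.
Proof.
have le_star b : `|b| <= `|star b|.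
  have [->|b0] := eqVneq b 0; first by rewrite normr0.
  have nb : 0 < `|b| by rewrite normr_gt0.
  by rewrite -(ler_pM2r nb) -expr2 -cstar_norm cmul_norm.
by apply/eqP; rewrite eq_le le_star -{2}[a]starK le_star.
Qed.

Lemma starN a : star (- a) = - star a.
Proof. by rewrite -scaleN1r starZ rmorphN rmorph1 scaleN1r. Qed.

Lemma star_continuous : continuous (@star R A).
Proof.
apply: (@lipschitz_cts R A A _ 1) => a b.
by rewrite mul1r -starN -starD star_norm.
Qed.

Lemma cmul0r a : a ** 0 = 0.
Proof. by rewrite -(scale0r (0 : A)) cmulZr !scale0r. Qed.

Lemma cmul0l a : 0 ** a = 0.
Proof. by rewrite -(scale0r (0 : A)) cmulZl !scale0r. Qed.

Lemma cmulr_continuous a : continuous (fun b => b ** a).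
Proof.
apply: (@lipschitz_cts R A A _ `|a|) => b c.
by rewrite -scaleN1r -cmulZl -cmulDl scaleN1r mulrC cmul_norm.
Qed.

Definition star_subalgebra B : Prop :=
  [/\ is_subspace B, forall b, B b -> B (star b) &
      forall a b, B a -> B b -> B (a ** b)].

(** On the zero space a linear functional vanishes, so its supremum could not be 1. *)
Lemma state_support {B phi} : state B phi -> exists2 b, B b & b != 0.
Proof.
case=> phil _ [_ lub]; apply: contrapT => Bb0.
have B0 b : B b -> b = 0.
  by move=> Bb; apply: contrapT => /eqP b0; apply: Bb0; exists b.
suff : (1 : R[i]) <= 0 by rewrite ler10.
apply: lub => _ [b [Bb _] <-]; move: (Bb); rewrite (B0 b Bb) => B_0.
have := phil 1 0 0 B_0 B_0; rewrite scale1r addr0 mul1r => /eqP.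
by rewrite eq_sym -subr_eq0 addrK => /eqP ->; rewrite normr0.
Qed.

(** * States of a subalgebra with a left unit [e], possibly different from [cone] *)

Section UnitalState.
Context {B : set A} {e : A}.
Hypothesis algB : star_subalgebra B.
Hypothesis Be : B e.
Hypothesis eB : forall b, B b -> e ** b = b.

Lemma left_unit_star : star e = e.
Proof.
have [_ Bs _] := algB.
by have := congr1 star (eB _ (Bs _ Be)); rewrite starM starK (eB _ (Bs _ Be)).
Qed.

(** Since [e] is self-adjoint, [star e ** e = e], and the C*-identity says that [|e|] equals its own
    square; a nonzero [b] forces [e != 0]. *)
Lemma left_unit_norm b : B b -> b != 0 -> `|e| = 1.
Proof.
move=> Bb b0; have e0 : e != 0.
  by apply: contraNneq b0 => e0; rewrite -(eB _ Bb) e0 cmul0l.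
have ne : `|e| != 0 by rewrite normr_eq0.
apply: (mulfI ne); rewrite mulr1 -expr2 -cstar_norm left_unit_star.
by rewrite eB.
Qed.

Context {phi : A -> R[i]}.
Hypothesis phiS : state B phi.

(** This is positivity of [phi] at [star c ** c] for [c = k *: b + e], expanded with [e]
    self-adjoint and hence a two-sided unit of [B]. *)
Lemma state_quadratic_ge0 b (k : R[i]) : B b ->
  0 <= k^* * k * phi (star b ** b) + (k^* * phi (star b) + (k * phi b + phi e)).
Proof.
have [Bsp Bs Bm] := algB; have [phil phip _] := phiS => Bb.
have Bsb := Bs _ Bb.
have Bke : B (k *: b + e) by apply: is_subspaceD => //; exact: is_subspaceZ.
have Bbb : B (star b ** b) by exact: Bm.
have Bsbke : B (k^* *: star b + (k *: b + e)).
  by apply: is_subspaceD => //; exact: is_subspaceZ.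
rewrite -(phil _ _ _ Bb Be) -(phil _ _ _ Bsb Bke) -(phil _ _ _ Bbb Bsbke).
apply: phip; exists (k *: b + e) => //.
rewrite starD starZ left_unit_star cmulDl !cmulDr !cmulZl !cmulZr scalerA.
have be : star b ** e = star b by rewrite -{1}left_unit_star -starM eB.
by rewrite be !eB// -addrA.
Qed.

(** In the quadratic expression the terms in [phi e] and [phi (star b ** b)] are real, so the cross
    terms are real for every [k]. *)
Lemma state_hermitian b : B b -> phi (star b) = (phi b)^*.
Proof.
have [_ Bs Bm] := algB; have [_ phip _] := phiS => Bb.
have real k : k^* * phi (star b) + k * phi b \is Num.real.
  have /ger0_real := state_quadratic_ge0 b k Bb.
  have e_real : phi e \is Num.real.
    by apply/ger0_real/phip; exists e => //; rewrite left_unit_star eB.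
  have bb_real : k^* * k * phi (star b ** b) \is Num.real.
    rewrite rpredM// ger0_real//; first by rewrite mulrC mul_conjC_ge0.
    by apply: phip; exists b.
  by rewrite rpredDl// addrA rpredDr.
exact: conj_of_real_pairing.
Qed.

(* Positivity at [e - conj(phi b) b] gives
   [0 <= phi e - 2 |phi b|^2 + |phi b|^2 phi (b* b)]. *)
Lemma state_CS b : B b -> `|b| <= 1 -> `|phi b| ^+ 2 <= phi e.
Proof.
have [_ Bs Bm] := algB; have [_ phip [ub _]] := phiS => Bb b1.
have bb_ge0 : 0 <= phi (star b ** b) by apply: phip; exists b.
have bb_le1 : phi (star b ** b) <= 1.
  rewrite -(ger0_norm bb_ge0); apply: ub; exists (star b ** b) => //.
  by split; [apply: Bm => //; exact: Bs | rewrite cstar_norm exprn_ile1].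
have := state_quadratic_ge0 b (- (phi b)^*) Bb.
rewrite state_hermitian// rmorphN /= conjCK mulrNN !mulNr -normCK.
rewrite [_^* * _]mulrC -normCK.
move=> quad_ge0; rewrite -subr_ge0; apply: le_trans quad_ge0 _.
have -> : phi e - `|phi b| ^+ 2 =
    `|phi b| ^+ 2 + (- `|phi b| ^+ 2 + (- `|phi b| ^+ 2 + phi e)).
  by ring.
by rewrite lerD2r ler_piMr// exprn_ge0.
Qed.

(** The upper bound holds because [e] is positive of norm one. For the lower one, [state_CS] makes
    [sqrtC (phi e)] an upper bound of the set whose supremum is 1. *)
Lemma state_unit : phi e = 1.
Proof.
have [_ Bs Bm] := algB; have [phil phip [ub lub]] := phiS.
have [b Bb b0] := state_support phiS.
have ge0 : 0 <= phi e by apply: phip; exists e => //; rewrite left_unit_star eB.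
apply/eqP; rewrite eq_le; apply/andP; split.
  rewrite -(ger0_norm ge0); apply: ub; exists e => //; split=> //.
  by rewrite (left_unit_norm _ Bb).
rewrite -[leRHS]sqrtCK -[leLHS](expr1n _ 2) ler_pXn2r ?nnegrE ?sqrtC_ge0//.
apply: lub => _ [c [Bc c1] <-].
by rewrite -[leLHS]sqrCK// ler_sqrtC ?nnegrE ?exprn_ge0// state_CS.
Qed.

End UnitalState.

Lemma star_subalgebraT : star_subalgebra [set: A].
Proof. by split=> //; apply/is_subspaceP. Qed.

Lemma state_cone phi : state [set: A] phi -> phi cone = 1.
Proof.
move=> phiS; apply: (state_unit star_subalgebraT _ _ phiS) => // b _.
exact: cmul1l.
Qed.

Lemma state_midpoint phi psi : state [set: A] phi -> state [set: A] psi ->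
  state [set: A] (fun a => (phi a + psi a) / 2).
Proof.
move=> phiS psiS; have [phil phip [phiub _]] := phiS.
have [psil psip [psiub _]] := psiS.
split=> [k a b _ _|a a0|]; first by rewrite phil// psil//; field.
  by rewrite divr_ge0// addr_ge0// ?phip ?psip.
split=> [_ [b [_ b1] <-]|u]; last first.
  move=> /(_ 1); apply; exists cone; last first.
    by rewrite !state_cone// divff ?normr1// (_ : 1 + 1 = 2%:R)// pnatr_eq0.
  (* The supremum is attained at [cone], which has norm one because an algebra with a state is
     nonzero. *)
  split=> //; have [b _ b0] := state_support phiS.
  by rewrite (left_unit_norm star_subalgebraT _ _ _ I b0)// => c _; exact: cmul1l.
rewrite normrM normfV normr_nat ler_pdivrMr// mul1r.
apply: le_trans (ler_normD _ _) _.
by apply: lerD; [apply: phiub|apply: psiub]; exists b.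
Qed.

End CStar.

(** * The C*-algebra spanned by the inner products of a ternary subspace *)

Section InnerSpan.
Context {R : realType} {A : cstarAlgType R} {E : hilbertModType A}.
Implicit Types (x y : E) (F : set E).

Lemma inner_span_star F a : inner_span F a -> inner_span F (star a).
Proof.
have /is_subspaceP[sp0 spl] :=
  @closed_span_subspace R A [set inner x y | x in F & y in F].
move: a; apply: (@closed_span_min _ _ _ (star @^-1` inner_span F)).
- apply/is_subspaceP; split=> [|k a b Sa Sb] /=.
    by rewrite -(scale0r (0 : A)) starZ rmorph0 scale0r.
  by rewrite starD starZ; exact: spl.
- apply: preimage_closed => [a _|]; first exact: star_continuous.
  exact: closed_closure.
- move=> _ [x Fx [y Fy <-]] /=; rewrite inner_star; apply: closed_span_gen.
  by exists y => //; exists x.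
Qed.

(** On a generator, [inner x y ** b = inner x (ract y b)], and ternarity keeps [ract y b] in [F];
    only the left factor needs the passage to the closed span. *)
Lemma inner_span_mul F a b : ternary F ->
  inner_span F a -> inner_span F b -> inner_span F (a ** b).
Proof.
move=> [_ _ Fact] Sa Sb; move: a Sa.
have /is_subspaceP[sp0 spl] :=
  @closed_span_subspace R A [set inner x y | x in F & y in F].
apply: (@closed_span_min _ _ _ ((fun a => a ** b) @^-1` inner_span F)).
- apply/is_subspaceP; split=> [|k c d Sc Sd] /=; first by rewrite cmul0l.
  by rewrite cmulDl cmulZl; exact: spl.
- apply: preimage_closed => [a _|]; first exact: cmulr_continuous.
  exact: closed_closure.
- move=> _ [x Fx [y Fy <-]] /=; rewrite -innerAr; apply: closed_span_gen.
  by exists x => //; exists (ract y b) => //; exact: Fact.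
Qed.

Lemma inner_span_star_subalgebra F : ternary F -> star_subalgebra (inner_span F).
Proof.
move=> ternF; split; first exact: closed_span_subspace.
  by move=> a; exact: inner_span_star.
by move=> a b; exact: inner_span_mul.
Qed.

Lemma mabs_positive x : positive setT (mabs x).
Proof.
rewrite /mabs; case: xgetP => [h _ []//|_].
(* The default value 0 of [xget] is positive as well. *)
by exists 0 => //; rewrite cmul0r.
Qed.

Lemma mabs2_inner x : mabs2 x = 0 \/ mabs2 x = inner x x.
Proof.
rewrite /mabs2 /mabs; case: xgetP => [h _ []//|_]; first by right.
by left; rewrite cmul0r.
Qed.

Section Unit.
Context {F : set E} {z : E} {phi : A -> R[i]}.
Hypotheses (ternF : ternary F) (Fz : F z).
Hypothesis z_unit : forall a, inner_span F a -> mabs2 z ** a = a.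
Hypothesis phiS : state (inner_span F) phi.

(* No square root needs to be constructed: if <z, z> had none, then mabs2 z
   would be the default 0, and the span would be zero and have no state. *)
Lemma mabs2_unit : mabs2 z = inner z z.
Proof.
have [b Fb b0] := state_support phiS; have [z0|//] := mabs2_inner z.
by move: b0; rewrite -(z_unit _ Fb) z0 cmul0l eqxx.
Qed.

Lemma inner_span_mabs2_unit : inner_span F (mabs2 z).
Proof.
by rewrite mabs2_unit; apply: closed_span_gen; exists z => //; exists z.
Qed.

(** Together with [state_mabs2_unit], this makes [z] admissible as the element [x_i] of the
    criterion, for every state of the span. *)
Lemma norm_unit : `|z| = 1.
Proof.
have [b Fb b0] := state_support phiS.
rewrite normE -mabs2_unit.
by rewrite (left_unit_norm (inner_span_star_subalgebra _ ternF)
  inner_span_mabs2_unit z_unit _ Fb b0) sqrtC1.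
Qed.

Lemma state_mabs2_unit : phi (mabs2 z) = 1.
Proof.
apply: (state_unit (inner_span_star_subalgebra _ ternF) _ z_unit phiS).
exact: inner_span_mabs2_unit.
Qed.

End Unit.

End InnerSpan.

(** * Equivalence of module independence with the criterion *)

Theorem theorem3p1 (R : realType) (A : cstarAlgType R) (E : hilbertModType A)
    (E1 E2 : set E) (ternE1 : ternary E1) (ternE2 : ternary E2)
    (z1 z2 : E) (E1z1 : E1 z1) (E2z2 : E2 z2)
    (z1_unit : forall a, inner_span E1 a -> mabs2 z1 ** a = a)
    (z2_unit : forall a, inner_span E2 a -> mabs2 z2 ** a = a) :
  module_independent E1 E2 <->
  exists m' M' : R, [/\ 0 < m', 0 < M' &
    forall (x1 x2 : E) (phi1 phi2 : A -> R[i]),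
      E1 x1 -> `|x1| = 1 -> E2 x2 -> `|x2| = 1 ->
      state (inner_span E1) phi1 -> phi1 (mabs2 x1) = 1 ->
      state (inner_span E2) phi2 -> phi2 (mabs2 x2) = 1 ->
    exists psi1 psi2 : A -> R[i],
      [/\ state setT psi1, state setT psi2,
          (forall z, E2 z ->
             psi1 (mabs z) <= M'%:C * sqrtC (phi2 (mabs2 z))) /\
          (forall z, E1 z ->
             m'%:C * phi1 (mabs z) <= psi1 (mabs z)
               <= M'%:C * sqrtC (phi1 (mabs2 z)))
        & (forall z, E1 z ->
             psi2 (mabs z) <= M'%:C * sqrtC (phi1 (mabs2 z))) /\
          (forall z, E2 z ->
             m'%:C * phi2 (mabs z) <= psi2 (mabs z)
               <= M'%:C * sqrtC (phi2 (mabs2 z)))]].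
Proof.
split=> [[m [M [m0 M0 ind]]]|[m [M [m0 M0 dom]]]].
  exists m, M; split=> // x1 x2 phi1 phi2 _ _ _ _ phi1S _ phi2S _.
  have [phi phiS [bound1 bound2]] := ind _ _ phi1S phi2S.
  exists phi, phi; split=> //; split=> // z Ez.
    by have /andP[] := bound2 z Ez.
  by have /andP[] := bound1 z Ez.
exists (m / 2), M; split=> // [|phi1 phi2 phi1S phi2S]; first by rewrite divr_gt0.
have [psi1 [psi2 [psi1S psi2S [upper12 bound1] [upper21 bound2]]]] :=
  dom z1 z2 phi1 phi2 E1z1 (norm_unit ternE1 E1z1 z1_unit phi1S)
    E2z2 (norm_unit ternE2 E2z2 z2_unit phi2S)
    phi1S (state_mabs2_unit ternE1 E1z1 z1_unit phi1S)
    phi2S (state_mabs2_unit ternE2 E2z2 z2_unit phi2S).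
exists (fun a => (psi1 a + psi2 a) / 2); first exact: state_midpoint.
have psi1_ge0 x : 0 <= psi1 (mabs x).
  by have [_ psi1p _] := psi1S; exact/psi1p/mabs_positive.
have psi2_ge0 x : 0 <= psi2 (mabs x).
  by have [_ psi2p _] := psi2S; exact/psi2p/mabs_positive.
(* Here [p] is the value of the state bounded below and [q] that of the other one. Dropping [q]
   turns [m] into [m / 2]; the mean of two values below [u] stays below [u], so [M] is kept. *)
have mean_bounds (l u p q : R[i]) :
    m%:C * l <= p -> 0 <= q -> p <= u -> q <= u ->
    (m / 2)%:C * l <= (p + q) / 2 <= u.
  move=> lp q0 pu qu.
  have -> : (m / 2)%:C * l = m%:C * l / 2.
    by rewrite rmorphM fmorphV rmorph_nat mulrAC.
  rewrite ler_pM2r ?invr_gt0// ler_pdivrMr// mulr_natr mulr2n.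
  by apply/andP; split; [rewrite ler_wpDr | exact: lerD].
split=> x Ex.
  have /andP[lo up] := bound1 x Ex.
  by apply: mean_bounds; rewrite ?upper21.
have /andP[lo up] := bound2 x Ex.
(* On [E2] the two states exchange roles: [psi2] gives the lower bound. *)
by rewrite addrC; apply: mean_bounds; rewrite ?upper12.
Qed.
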